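(* Let $d\in\mathbb{N}$ and let $\mu\in\mathcal{M}$ be different from the Lebesgue measure on $\mathbb{T}^d$. Then there is a constant $c>0$ (depending on $\mu$) such that for all $n\in\mathbb{N}$ $$W_1(p_n,\mu)\ge\frac{c}{n+1},$$ where $p_n=F_n*\mu$.
   Context: $\mathbb{N}=\{1,2,\dots\}$, $\mathbb{T}^d=[0,1)^d$ is the torus with wrap-around distance $|x-y|_1=\min_{k\in\mathbb{Z}^d}\|x-y+k\|_1$. $\mathcal{M}$ is the set of complex Borel measures $\mu$ on $\mathbb{T}^d$ of finite total variation with $\mu(\mathbb{T}^d)=1$. The Fejér kernel is $F_n(x)=\sum_{k=-n}^n\left(1-\frac{|k|}{n+1}\right)e^{2\pi i kx}$ for $x\in\mathbb{T}$ and $F_n(x_1,\dots,x_d)=F_n(x_1)\cdots F_n(x_d)$ on $\mathbb{T}^d$; $(F_n*\mu)(x)=\int_{\mathbb{T}^d}F_n(x-y)\,\mathrm{d}\mu(y)$. For $f:\mathbb{T}^d\to\mathbb{R}$, $\operatorname{Lip}(f)\le1$ means $|f(x)-f(y)|\le|x-y|_1$ for all $x,y$. $W_1(\nu,\mu)=\sup_{\operatorname{Lip}(f)\le1}\left|\int_{\mathbb{T}^d}f\,\mathrm{d}(\nu-\mu)\right|$, and $W_1(p,\mu)$ means $W_1(\nu,\mu)$ with $\mathrm{d}\nu(x)=p(x)\,\mathrm{d}x$. *)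

(* Defs.v *)
From HB Require Import structures.
From mathcomp Require Import all_boot all_order all_algebra.
From mathcomp Require Import all_classical all_reals all_analysis.
From mathcomp Require Import complex.

Set Implicit Arguments.
Unset Strict Implicit.
Unset Printing Implicit Defensive.
Import Order.TTheory GRing.Theory Num.Theory.
Import numFieldNormedType.Exports.

Local Open Scope classical_set_scope.
Local Open Scope ring_scope.
Local Open Scope complex_scope.

(* A complex measure is a countably additive function with values in R[i].
   The alias R[i]^o is what carries the library's topology on R[i]; values on
   non-measurable sets are irrelevant. *)
Record complex_measure d (T : measurableType d) (R : realType) :=
  ComplexMeasure {
    cm_fun :> set T -> R[i] ;
    cm_set0 : cm_fun set0 = 0 ;
    cm_sigma_additive : forall F : (set T)^nat,
      (forall i, measurable (F i)) -> trivIset setT F ->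
      (fun n => \sum_(0 <= i < n) cm_fun (F i) : R[i]^o) @ \oo
        --> (cm_fun (\bigcup_i F i) : R[i]^o) }.
Arguments complex_measure {d} T R.

Definition cm_eq d (T : measurableType d) (R : realType)
    (mu nu : complex_measure T R) :=
  forall A, measurable A -> mu A = nu A.

Definition cm_variation d (T : measurableType d) (R : realType)
    (mu : complex_measure T R) (A : set T) : \bar R :=
  ereal_sup [set v | exists n (E : 'I_n -> set T),
    [/\ forall i, measurable (E i), trivIset setT E, \bigcup_i E i = A &
        v = (\sum_(i < n) Normc.normc (mu (E i)))%:E]].

Section complex_cvg.
Context {R : realType}.
Implicit Types (u : nat -> R[i]) (l : R[i]).

Lemma cvg_complex_part (g : {additive R[i] -> R}) u l :
  (forall z, `|g z| <= Normc.normc z) ->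
  ((u : nat -> R[i]^o) @ \oo --> (l : R[i]^o)) -> g (u n) @[n --> \oo] --> g l.
Proof.
move=> gle /cvgrPdist_lt ul; apply/cvgrPdist_lt => e e0.
have e0C : 0 < e%:C :> R[i] by rewrite ltcR.
apply: filterS (ul _ e0C) => n; rewrite -raddfB => h.
by apply: le_lt_trans (gle _) _; rewrite -ltcR.
Qed.

Lemma normc_Re (z : R[i]) : `|complex.Re z| <= Normc.normc z.
Proof.
by case: z => a b /=; rewrite -sqrtr_sqr ler_wsqrtr// lerDl sqr_ge0.
Qed.

Lemma normc_Im (z : R[i]) : `|complex.Im z| <= Normc.normc z.
Proof.
by case: z => a b /=; rewrite -sqrtr_sqr ler_wsqrtr// lerDr sqr_ge0.
Qed.

Lemma cvg_complex u l :
  complex.Re (u n) @[n --> \oo] --> complex.Re l ->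
  complex.Im (u n) @[n --> \oo] --> complex.Im l ->
  (u : nat -> R[i]^o) @ \oo --> (l : R[i]^o).
Proof.
move=> /cvgrPdist_lt ure /cvgrPdist_lt uim; apply/cvgrPdist_lt => e.
case: e => e e'; rewrite ltcE/= => /andP[/eqP e'0 e0]; rewrite e'0.
have e20 : 0 < e / 2 by rewrite divr_gt0.
near=> n; have -> : e +i* 0 = (e / 2)%:C + (e / 2)%:C :> R[i].
  by rewrite -rmorphD/= -splitr.
have -> : (l - u n : R[i]^o) =
    (complex.Re l - complex.Re (u n))%:C +
    'i * (complex.Im l - complex.Im (u n))%:C :> R[i].
  by case: (l) => a b; case: (u n) => a' b'; simpc.
apply: le_lt_trans (ler_normD _ _) _; rewrite normrM.
have -> : `|'i : R[i]| = 1 by rewrite normc_def/= expr0n expr1n add0r sqrtr1.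
rewrite mul1r !normc_def/= expr0n !addr0 !sqrtr_sqr.
by apply: ltrD; rewrite ltcR; near: n; [exact: ure|exact: uim].
Unshelve. all: by end_near. Qed.

End complex_cvg.

Section parts.
Context d (T : measurableType d) (R : realType) (mu : complex_measure T R).

Definition cm_Re (A : set T) : \bar R := (complex.Re (mu A))%:E.
Definition cm_Im (A : set T) : \bar R := (complex.Im (mu A))%:E.

Let cm_Re0 : cm_Re set0 = 0%E.
Proof. by rewrite /cm_Re cm_set0. Qed.

Let cm_Im0 : cm_Im set0 = 0%E.
Proof. by rewrite /cm_Im cm_set0. Qed.

Let cm_Re_sigma_additive : semi_sigma_additive cm_Re.
Proof.
move=> F mF tF mUF; rewrite /cm_Re.
under eq_fun do rewrite sumEFin -raddf_sum.
apply: cvg_EFin; first by apply: nearW.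
apply: (@cvg_complex_part _ (@complex.Re R) _ (mu (\bigcup_i F i))).
  exact: normc_Re.
exact: cm_sigma_additive.
Qed.

Let cm_Im_sigma_additive : semi_sigma_additive cm_Im.
Proof.
move=> F mF tF mUF; rewrite /cm_Im.
under eq_fun do rewrite sumEFin -raddf_sum.
apply: cvg_EFin; first by apply: nearW.
apply: (@cvg_complex_part _ (@complex.Im R) _ (mu (\bigcup_i F i))).
  exact: normc_Im.
exact: cm_sigma_additive.
Qed.

HB.instance Definition _ := isCharge.Build _ _ _ cm_Re
  cm_Re0 (fun _ _ => isT) cm_Re_sigma_additive.

HB.instance Definition _ := isCharge.Build _ _ _ cm_Im
  cm_Im0 (fun _ _ => isT) cm_Im_sigma_additive.

End parts.

Section of_charges.
Context d (T : measurableType d) (R : realType).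
Variables (a b : {charge set T -> \bar R}).

Definition of_charges (A : set T) : R[i] := fine (a A) +i* fine (b A).

Lemma of_charges0 : of_charges set0 = 0.
Proof. by rewrite /of_charges !charge0. Qed.

Lemma charge_fine_cvg (nu : {charge set T -> \bar R}) (F : (set T)^nat) :
  (forall i, measurable (F i)) -> trivIset setT F ->
  \sum_(0 <= i < n) fine (nu (F i)) @[n --> \oo] --> fine (nu (\bigcup_i F i)).
Proof.
move=> mF tF; have mUF := bigcupT_measurable _ mF.
have h : (\sum_(0 <= i < n) nu (F i))%E @[n --> \oo]
    --> (fine (nu (\bigcup_i F i)))%:E.
  rewrite fineK; last exact: fin_num_measure.
  exact: charge_semi_sigma_additive.
have /fine_cvgP[_] := h; apply: cvg_trans; apply: near_eq_cvg; near=> n => /=.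
by rewrite sum_fine// => i _; exact: fin_num_measure.
Unshelve. all: by end_near. Qed.

Lemma of_charges_sigma_additive (F : (set T)^nat) :
  (forall i, measurable (F i)) -> trivIset setT F ->
  (fun n => \sum_(0 <= i < n) of_charges (F i) : R[i]^o) @ \oo
    --> (of_charges (\bigcup_i F i) : R[i]^o).
Proof.
move=> mF tF; apply: cvg_complex => /=.
  under eq_fun do rewrite raddf_sum/=; exact: charge_fine_cvg.
under eq_fun do rewrite raddf_sum/=; exact: charge_fine_cvg.
Qed.

Definition cm_of_charges : complex_measure T R :=
  ComplexMeasure of_charges0 of_charges_sigma_additive.

End of_charges.

Definition cm_sub d (T : measurableType d) (R : realType)
    (nu mu : complex_measure T R) : complex_measure T R :=
  cm_of_charges (cadd (cm_Re nu) (copp (cm_Re mu)))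
                (cadd (cm_Im nu) (copp (cm_Im mu))).

Definition cm_of_measure d (T : measurableType d) (R : realType)
    (m : {finite_measure set T -> \bar R}) : complex_measure T R :=
  cm_of_charges (charge_of_finite_measure m) czero.

(* The measure p dm, with the junk value 0 if p is not integrable. *)
Definition cm_density d (T : measurableType d) (R : realType)
    (m : {measure set T -> \bar R}) (p : T -> R[i]) : complex_measure T R :=
  match pselect (m.-integrable setT (fun x => (complex.Re (p x))%:E)),
        pselect (m.-integrable setT (fun x => (complex.Im (p x))%:E)) with
  | left intRe, left intIm =>
      cm_of_charges (induced_charge intRe) (induced_charge intIm)
  | _, _ => cm_of_charges czero czero
  end.

Section integral.
Context d (T : measurableType d) (R : realType).

Lemma Hahn_decomposition_sig (nu : {charge set T -> \bar R}) :
  {PN : set T * set T | hahn_decomposition nu PN.1 PN.2}.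
Proof.
by apply: cid; have [P [N PN]] := Hahn_decomposition nu; exists (P, N).
Qed.

(* Integral against a signed measure through its Jordan decomposition, which
   does not depend on the choice of the Hahn decomposition. *)
Definition charge_integral (nu : {charge set T -> \bar R}) (f : T -> R) : R :=
  let PN := svalP (Hahn_decomposition_sig nu) in
  \int[jordan_pos PN]_x f x - \int[jordan_neg PN]_x f x.

Definition cm_integral (mu : complex_measure T R) (f : T -> R[i]) : R[i] :=
  let u x := complex.Re (f x) in let v x := complex.Im (f x) in
  (charge_integral (cm_Re mu) u - charge_integral (cm_Im mu) v) +i*
  (charge_integral (cm_Im mu) u + charge_integral (cm_Re mu) v).

End integral.

Record circle (R : realType) := Circle { cval :> R ; _ : 0 <= cval < 1 }.

HB.instance Definition _ (R : realType) := [isSub for @cval R].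
HB.instance Definition _ (R : realType) := [Choice of circle R by <:].

Lemma circle0_subproof (R : realType) : 0 <= (0 : R) < 1.
Proof. by rewrite lexx ltr01. Qed.

HB.instance Definition _ (R : realType) :=
  isPointed.Build (circle R) (Circle (circle0_subproof R)).

Definition circle_display : measure_display.
Proof. exact: default_measure_display. Qed.

Section circle_measurable.
Context (R : realType).

(* Borel sets of [0, 1[, i.e. traces of Borel sets of the line. *)
Definition circle_borel : set (set (circle R)) :=
  preimage_set_system setT (@cval R : circle R -> measurableTypeR R) measurable.

Let circle_borel0 : circle_borel set0.
Proof. by exists set0 => //; rewrite preimage_set0 setI0. Qed.

Let circle_borelC A : circle_borel A -> circle_borel (~` A).
Proof.
move=> [B mB <-]; exists (~` B); first exact: measurableC.
by rewrite !setTI.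
Qed.

Let circle_borel_bigcup (F : (set (circle R))^nat) :
  (forall i, circle_borel (F i)) -> circle_borel (\bigcup_i F i).
Proof.
move=> mF; pose G i := sval (cid2 (mF i)).
exists (\bigcup_i G i).
  by apply: bigcupT_measurable => i; rewrite /G; case: cid2.
rewrite setTI preimage_bigcup; apply: eq_bigcupr => i _.
by rewrite /G; case: cid2 => B /= _ <-; rewrite setTI.
Qed.

HB.instance Definition _ := @isMeasurable.Build circle_display (circle R)
  circle_borel circle_borel0 circle_borelC circle_borel_bigcup.

End circle_measurable.

Section circle_lebesgue.
Context (R : realType).
Local Open Scope ereal_scope.

Definition circle_lebesgue (A : set (circle R)) : \bar R :=
  lebesgue_measure (@cval R @` A).

Lemma measurable_cval_image (A : set (circle R)) : measurable A ->
  measurable (@cval R @` A : set (measurableTypeR R)).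
Proof.
move=> [B mB <-]; rewrite setTI.
rewrite (_ : _ @` _ = B `&` `[0%R, 1%R[%classic); last first.
  apply/seteqP; split => [_ [[x x01] /= Bx <-]|x /= [Bx]].
    by split => //=; rewrite in_itv.
  by rewrite in_itv/= => x01; exists (Circle x01).
by apply: measurableI => //; exact: measurable_itv.
Qed.

Let circle_lebesgue0 : circle_lebesgue set0 = 0.
Proof. by rewrite /circle_lebesgue image_set0 measure0. Qed.

Let circle_lebesgue_ge0 A : 0 <= circle_lebesgue A.
Proof. exact: measure_ge0. Qed.

Let circle_lebesgue_sigma_additive : semi_sigma_additive circle_lebesgue.
Proof.
move=> F mF tF mUF; rewrite /circle_lebesgue image_bigcup.
apply: measure_semi_sigma_additive.
- by move=> i; exact: measurable_cval_image.
- apply/trivIsetP => i j _ _ ij; apply/seteqP; split => // z [].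
  move=> [x Fx <-] [y Fy /val_inj yx]; move/trivIsetP : tF => /(_ _ _ I I ij).
  by move=> /seteqP[+ _] => /(_ x); apply; split => //; rewrite -yx.
- by rewrite -image_bigcup; exact: measurable_cval_image.
Qed.

HB.instance Definition _ := isMeasure.Build _ _ _ circle_lebesgue
  circle_lebesgue0 circle_lebesgue_ge0 circle_lebesgue_sigma_additive.

Let circle_lebesgueT : circle_lebesgue setT = 1.
Proof.
rewrite /circle_lebesgue (_ : _ @` _ = `[0%R, 1%R[%classic); last first.
  apply/seteqP; split => [_ [[x x01] _ <-]|x /=].
    by rewrite /= in_itv.
  by rewrite in_itv/= => x01; exists (Circle x01).
by rewrite lebesgue_measure_itv/= lte01 oppr0 adde0.
Qed.

HB.instance Definition _ := Measure_isProbability.Build _ _ _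
  circle_lebesgue circle_lebesgueT.

End circle_lebesgue.

(* The torus [0, 1[ ^ d, with the product sigma-algebra (which is the Borel
   sigma-algebra). *)
Notation torus R d := (d.-tuple (circle R)).

Definition torus_cons (R : realType) d (p : circle R * torus R d) :
  torus R d.+1 := [tuple of p.1 :: p.2].

Lemma measurable_torus_cons (R : realType) d :
  measurable_fun setT (@torus_cons R d).
Proof. exact: measurable_cons. Qed.

HB.instance Definition _ (R : realType) d :=
  isMeasurableFun.Build _ _ _ _ (@torus_cons R d) (@measurable_torus_cons R d).

(* Lebesgue measure on the torus: iterated product of the one on [0, 1[. *)
Fixpoint torus_lebesgue (R : realType) d : probability (torus R d) R :=
  if d is d'.+1 then
    distribution (@circle_lebesgue R \x torus_lebesgue R d')%E (@torus_cons R d')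
  else \d_([tuple]).

Section torus.
Context {R : realType} {d : nat}.
Implicit Types (x y : torus R d) (mu nu : complex_measure (torus R d) R).

Definition torus_diff x y : 'I_d -> R :=
  fun i => cval (tnth x i) - cval (tnth y i).

(* The infimum is a minimum. *)
Definition torus_dist x y : R :=
  inf [set \sum_(i < d) `|torus_diff x y i + (k i)%:~R|
      | k in [set: 'I_d -> int]].

Definition torus_lip1 (f : torus R d -> R) :=
  forall x y, `|f x - f y| <= torus_dist x y.

Definition W1 nu mu : \bar R :=
  ereal_sup
    [set (Normc.normc (cm_integral (cm_sub nu mu) (fun x => (f x)%:C)))%:E
    | f in torus_lip1].

Definition in_M mu := (cm_variation mu setT < +oo)%E /\ mu setT = 1.

Definition expi (t : R) : R[i] := cos t +i* sin t.

Definition fejer1 (n : nat) (t : R) : R[i] :=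
  \sum_(j < n.*2.+1) let k := j%:Z - n%:Z in
    (1 - `|k|%N%:R / n.+1%:R)%:C * expi (2 * pi * k%:~R * t).

Definition fejer (n : nat) (t : 'I_d -> R) : R[i] := \prod_(i < d) fejer1 n (t i).

(* fejer is 1-periodic in each coordinate, so x - y need not be reduced. *)
Definition fejer_conv (n : nat) mu : torus R d -> R[i] :=
  fun x => cm_integral mu (fun y => fejer n (torus_diff x y)).

End torus.

(* Main.v *)
Require Import Defs.
From mathcomp Require Import all_boot all_order all_algebra.
From mathcomp Require Import all_classical all_reals all_analysis.
From mathcomp Require Import complex.
From mathcomp Require Import finmap measurable_realfun ring lra zify.
Import Order.TTheory GRing.Theory Num.Theory.
Import numFieldNormedType.Exports.

(* Convolution with the Fejér kernel multiplies the Fourier coefficient of [mu]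
   at a frequency [k] by a number in [0, 1 - 1/(n+1)] as soon as [k != 0], so
   [p_n] and [mu] differ at [k] by at least [|mu^(k)| / (n+1)].  The real and
   imaginary parts of the character of frequency [k] are Lipschitz, whence the
   bound, provided some [mu^(k)] with [k != 0] does not vanish.

   This last point is the uniqueness of Fourier coefficients.  Integrals against
   two charges agree on the closure of the trigonometric waves under linear
   combinations and bounded pointwise limits.  This closure is stable under
   products; as the iterates of [t |-> (3 t - t^3) / 2] converge to the sign of
   [t] on [-1, 1], it contains the indicators of the sets [{f > 0}] for its
   members [f], hence of all the measurable sets. *)

Set Implicit Arguments.
Unset Strict Implicit.
Unset Printing Implicit Defensive.

Local Open Scope classical_set_scope.
Local Open Scope ring_scope.

(** * Functionals that behave like integrals *)

Section bounded_measurable.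
Import HBNNSimple.
Context d (T : measurableType d) (R : realType).
Implicit Types (f g : T -> R) (A : set T).

(** Such functions are integrable against every finite measure and are stable under sums and
    products, so the identities below need no separate integrability hypotheses. *)
Definition bounded_measurable f :=
  measurable_fun setT f /\ exists M, forall x, `|f x| <= M.

Lemma bounded_measurable_cst (a : R) : bounded_measurable (fun _ => a).
Proof. by split; [exact: measurable_cst|exists `|a|]. Qed.

Lemma bounded_measurableD f g : bounded_measurable f -> bounded_measurable g ->
  bounded_measurable (fun x => f x + g x).
Proof.
move=> [mf [M fM]] [mg [N gN]]; split; first exact: measurable_funD.
by exists (M + N) => x; apply: le_trans (ler_normD _ _) (lerD _ _).
Qed.

Lemma bounded_measurableM f g : bounded_measurable f -> bounded_measurable g ->
  bounded_measurable (fun x => f x * g x).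
Proof.
move=> [mf [M fM]] [mg [N gN]]; split; first exact: measurable_funM.
by exists (M * N) => x; rewrite normrM ler_pM.
Qed.

Lemma bounded_measurableZ a f : bounded_measurable f ->
  bounded_measurable (fun x => a * f x).
Proof. by move=> bf; apply: bounded_measurableM => //; exact: bounded_measurable_cst. Qed.

Lemma bounded_measurableN f : bounded_measurable f ->
  bounded_measurable (fun x => - f x).
Proof.
move=> bf; rewrite (_ : (fun _ => _) = fun x => -1 * f x).
  exact: bounded_measurableZ.
by apply/funext => x; rewrite mulN1r.
Qed.

Lemma bounded_measurableB f g : bounded_measurable f -> bounded_measurable g ->
  bounded_measurable (fun x => f x - g x).
Proof.
by move=> bf bg; apply: bounded_measurableD => //; exact: bounded_measurableN.
Qed.

Lemma bounded_measurable_indic A : measurable A ->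
  bounded_measurable (\1_A : T -> R).
Proof.
move=> mA; split; first exact: measurable_indic.
by exists 1 => x; rewrite indicE; case: (x \in A); rewrite ?normr0 ?normr1.
Qed.

Lemma bounded_measurable_sum (I : Type) (s : seq I) (F : I -> T -> R) :
  (forall i, bounded_measurable (F i)) ->
  bounded_measurable (fun x => \sum_(i <- s) F i x).
Proof.
move=> bF; elim: s => [|i s ih].
  by under eq_fun do rewrite big_nil; exact: bounded_measurable_cst.
by under eq_fun do rewrite big_cons; exact: bounded_measurableD.
Qed.

Lemma bounded_measurable_cvg (u : nat -> T -> R) f (M : R) :
  (forall n, measurable_fun setT (u n)) -> (forall n x, `|u n x| <= M) ->
  (forall x, u n x @[n --> \oo] --> f x) -> bounded_measurable f.
Proof.
move=> mu uM uf; split.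
  by apply: (@measurable_fun_cvg _ _ _ setT u f) => // x _; exact: uf.
exists M => x; have /cvg_norm cx := uf x.
rewrite -(cvg_lim _ cx)//; apply: limr_le; first by apply/cvg_ex; exists `|f x|.
by apply: nearW => n; exact: uM.
Qed.

Lemma bounded_measurable_integrable (m : {finite_measure set T -> \bar R}) f :
  bounded_measurable f -> m.-integrable setT (EFin \o f).
Proof.
move=> [mf [M fM]]; apply: measurable_bounded_integrable => //.
  by rewrite ltey_eq fin_num_measure.
exists M; split; first exact: num_real.
by move=> N MN x _; exact: le_trans (fM x) (ltW MN).
Qed.

(* The algebraic content of being integration against a signed measure. *)
Record integral_like (L : (T -> R) -> R) : Prop := IntegralLike {
  il_linear : forall a f g, bounded_measurable f -> bounded_measurable g ->
    L (fun x => a * f x + g x) = a * L f + L g ;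
  il_cvg : forall (u : nat -> T -> R) f M,
    (forall n, measurable_fun setT (u n)) -> (forall n x, `|u n x| <= M) ->
    (forall x, u n x @[n --> \oo] --> f x) -> L (u n) @[n --> \oo] --> L f }.

(** The limit rule is dominated convergence with the constant majorant [M], which is integrable
    because the measure is finite. *)
Lemma integral_like_Rintegral (m : {finite_measure set T -> \bar R}) :
  integral_like (fun f => \int[m]_x f x).
Proof.
split=> [a f g bf bg|u f M mu uM uf].
  have i_f := bounded_measurable_integrable m bf.
  rewrite RintegralD//; first by rewrite RintegralZl.
    exact: (bounded_measurable_integrable m (bounded_measurableZ a bf)).
  exact: bounded_measurable_integrable.
have [mf _] := bounded_measurable_cvg mu uM uf.
have [] := @dominated_convergence _ _ _ m setT measurableT
  (fun n => EFin \o u n) (EFin \o f) (fun _ => M%:E).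
- by move=> n; exact/measurable_EFinP.
- exact/measurable_EFinP.
- by apply: aeW => x _; apply: cvg_EFin; [exact: nearW|exact: uf].
- exact: (bounded_measurable_integrable m (bounded_measurable_cst M)).
- by apply: aeW => x n _ /=; rewrite lee_fin.
move=> i_f _ h.
apply: fine_cvg; rewrite /Rintegral fineK//.
exact: integrable_fin_num.
Qed.

Section theory.
Variables (L K : (T -> R) -> R).
Hypotheses (Lil : integral_like L) (Kil : integral_like K).

Lemma il0 : L (fun _ => 0) = 0.
Proof.
have := il_linear Lil (-1) (bounded_measurable_cst 0) (bounded_measurable_cst 0).
by rewrite mulr0 addr0 mulN1r addNr.
Qed.

Lemma ilD f g : bounded_measurable f -> bounded_measurable g ->
  L (fun x => f x + g x) = L f + L g.
Proof.
move=> bf bg; rewrite -[L f]mul1r -il_linear//.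
by congr L; apply/funext => x; rewrite mul1r.
Qed.

Lemma ilZ a f : bounded_measurable f -> L (fun x => a * f x) = a * L f.
Proof.
move=> bf; rewrite -[RHS]addr0 -il0 -il_linear//.
  by congr L; apply/funext => x; rewrite addr0.
exact: bounded_measurable_cst.
Qed.

Lemma ilN f : bounded_measurable f -> L (fun x => - f x) = - L f.
Proof.
move=> bf; rewrite -mulN1r -ilZ//.
by congr L; apply/funext => x; rewrite mulN1r.
Qed.

Lemma ilB f g : bounded_measurable f -> bounded_measurable g ->
  L (fun x => f x - g x) = L f - L g.
Proof.
by move=> bf bg; rewrite ilD ?ilN//; exact: bounded_measurableN.
Qed.

Lemma il_sum (I : Type) (s : seq I) (F : I -> T -> R) :
  (forall i, bounded_measurable (F i)) ->
  L (fun x => \sum_(i <- s) F i x) = \sum_(i <- s) L (F i).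
Proof.
move=> bF; elim: s => [|i s ih].
  rewrite big_nil -[RHS]il0; congr L.
  by apply/funext => x; rewrite big_nil.
rewrite big_cons -ih -ilD//; last exact: bounded_measurable_sum.
by congr L; apply/funext => x; rewrite big_cons.
Qed.

Lemma integral_likeB : integral_like (fun f => L f - K f).
Proof.
split=> [a f g bf bg|u f M mu uM uf]; first by rewrite !il_linear//; ring.
by apply: cvgB; exact: il_cvg uf.
Qed.

Lemma integral_likeD : integral_like (fun f => L f + K f).
Proof.
split=> [a f g bf bg|u f M mu uM uf]; first by rewrite !il_linear//; ring.
by apply: cvgD; exact: il_cvg uf.
Qed.

(** Abstract form of passing to the measure with density [g]. *)
Lemma integral_likeM g : bounded_measurable g ->
  integral_like (fun f => L (fun x => f x * g x)).
Proof.
move=> bg; split=> [a f h bf bh|u f M mu uM uf].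
  rewrite -il_linear//; [|exact: bounded_measurableM..].
  by congr L; apply/funext => x; ring.
have [mg [N gN]] := bg.
apply: (@il_cvg _ Lil _ _ (M * N)) => [n|n x|x].
- exact: measurable_funM.
- by rewrite normrM ler_pM.
- by apply: cvgMr_tmp; exact: uf.
Qed.

End theory.

(** Linearity extends the equality from indicators to simple functions, and bounded limits extend it
    to nonnegative functions. *)
Lemma integral_like_ext L K : integral_like L -> integral_like K ->
  (forall A, measurable A -> L (\1_A) = K (\1_A)) ->
  forall f, bounded_measurable f -> L f = K f.
Proof.
move=> Lil Kil LK.
have sfun_eq (h : {nnsfun T >-> R}) : L (h : T -> R) = K (h : T -> R).
  have bi (c : R) : bounded_measurable (fun x => c * \1_(h @^-1` [set c]) x : R).
    by apply: bounded_measurableZ; apply: bounded_measurable_indic.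
  have hE : (h : T -> R) = fun x =>
      \sum_(c <- fset_set (range h)) (c * \1_(h @^-1` [set c]) x).
    by apply/funext => x; rewrite fimfunE fsbig_finite.
  rewrite hE !il_sum//; apply: eq_bigr => c _.
  have bc : bounded_measurable (\1_(h @^-1` [set c]) : T -> R).
    exact: bounded_measurable_indic.
  rewrite !ilZ//.
  by rewrite LK.
have pos_eq f : bounded_measurable f -> (forall x, 0 <= f x) -> L f = K f.
  move=> [mf [M fM]] f0.
  have mEf : measurable_fun setT (EFin \o f) by exact/measurable_EFinP.
  pose u := nnsfun_approx measurableT mEf.
  have uM n x : `|u n x| <= M.
    rewrite ger0_norm//; apply: le_trans (fM x); rewrite ger0_norm// -lee_fin.
    rewrite /u nnsfun_approxE; apply: (@le_approx _ _ _ setT (EFin \o f)) => //.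
    by move=> y _; rewrite lee_fin.
  have uf x : u n x @[n --> \oo] --> f x.
    suff /fine_cvgP[] : EFin \o u^~ x @ \oo --> (f x)%:E by [].
    by apply: (@cvg_nnsfun_approx _ _ _ setT measurableT (EFin \o f) mEf) => // y _;
      rewrite lee_fin.
  have mu n : measurable_fun setT (u n : T -> R) by [].
  have Lu := il_cvg Lil mu uM uf; have Ku := il_cvg Kil mu uM uf.
  apply: (cvg_unique _ Lu) => //.
  by rewrite (_ : (fun n => _) = fun n => K (u n)); [exact: Ku|apply/funext => n].

(* Adding the bound [M] makes [f] nonnegative; the contribution of the constant [M] then cancels on
   both sides. *)
move=> f bf; have [mf [M fM]] := bf.
have bM := bounded_measurable_cst M.
have := pos_eq _ (bounded_measurableD bf bM).
rewrite !ilD// (pos_eq (fun _ => M)) => [|//|x]; last exact: le_trans (fM x).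
move=> h; apply: (addIr (K (fun _ => M))); apply: h => x.
by have := fM x; rewrite ler_norml => /andP[]; rewrite -subr_ge0 opprK.
Qed.

End bounded_measurable.

(** * Integration against signed charges *)

Section charge_integral.
Context d (T : measurableType d) (R : realType).
Implicit Types (nu : {charge set T -> \bar R}) (f : T -> R).

Lemma integral_like_charge nu : integral_like (charge_integral nu).
Proof. by apply: integral_likeB; exact: integral_like_Rintegral. Qed.

Lemma Rintegral_indicT (m : {measure set T -> \bar R}) A : measurable A ->
  \int[m]_x (\1_A x : R) = fine (m A).
Proof. by move=> mA; rewrite /Rintegral integral_indic// setIT. Qed.

Lemma charge_integral_indic nu A : measurable A ->
  charge_integral nu \1_A = fine (nu A).
Proof.
move=> mA; rewrite /charge_integral !Rintegral_indicT//.
rewrite [in RHS](jordan_decomp (svalP (Hahn_decomposition_sig nu)) mA).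
rewrite /cadd/= cscaleN1.
by rewrite fineB// fin_num_measure.
Qed.

(** Identifies an integral against a charge from its values on measurable sets alone, so that Hahn
    decompositions of different charges never have to be compared. *)
Lemma charge_integral_eq nu (L : (T -> R) -> R) : integral_like L ->
  (forall A, measurable A -> fine (nu A) = L \1_A) ->
  forall f, bounded_measurable f -> charge_integral nu f = L f.
Proof.
move=> Lil nuL; apply: integral_like_ext => //.
  exact: integral_like_charge.
by move=> A mA; rewrite charge_integral_indic// nuL.
Qed.

Lemma charge_integral_cadd nu1 nu2 f : bounded_measurable f ->
  charge_integral (cadd nu1 nu2) f = charge_integral nu1 f + charge_integral nu2 f.
Proof.
apply: (@charge_integral_eq _
  (fun f => charge_integral nu1 f + charge_integral nu2 f)).
  by apply: integral_likeD; exact: integral_like_charge.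
by move=> A mA; rewrite !charge_integral_indic// /cadd fineD// fin_num_measure.
Qed.

Lemma charge_integral_copp nu f : bounded_measurable f ->
  charge_integral (copp nu) f = - charge_integral nu f.
Proof.
move=> bf; rewrite -[RHS]mulN1r -(ilZ (integral_like_charge nu)) //.
(* Negation is written as multiplication of the integrand by -1, so that [integral_likeM]
   applies. *)
have := @charge_integral_eq (copp nu)
  (fun f => charge_integral nu (fun x => f x * -1)).
move=> ->//.
- by congr charge_integral; apply/funext => x; rewrite mulrC.
- apply: (integral_likeM (integral_like_charge nu)).
  exact: bounded_measurable_cst.
- move=> A mA; rewrite [X in charge_integral _ X](_ : _ = fun x => -1 * \1_A x).
    rewrite (ilZ (integral_like_charge nu))//.
      by rewrite charge_integral_indic// mulN1r fineN.
    exact: bounded_measurable_indic.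
  by apply/funext => x; rewrite mulrC.
Qed.

Lemma charge_integral_measure (m : {finite_measure set T -> \bar R}) f :
  bounded_measurable f ->
  charge_integral (charge_of_finite_measure m) f = \int[m]_x f x.
Proof.
apply: (@charge_integral_eq _ (fun f => \int[m]_x f x)).
  exact: integral_like_Rintegral.
by move=> A mA; rewrite Rintegral_indicT.
Qed.

Lemma charge_integral_induced (m : {finite_measure set T -> \bar R}) (g : T -> R)
    (intg : m.-integrable setT (fun x => (g x)%:E)) f :
  bounded_measurable g -> bounded_measurable f ->
  charge_integral (induced_charge intg) f = \int[m]_x (f x * g x).
Proof.
move=> bg; apply: (@charge_integral_eq _ (fun f => \int[m]_x (f x * g x))).
  by apply: integral_likeM => //; exact: integral_like_Rintegral.
move=> A mA; rewrite /Rintegral; congr fine.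
rewrite [LHS]integral_mkcond; apply: eq_integral => x _; rewrite patchE indicE.
by case: (x \in A); rewrite ?mul1r ?mul0r.
Qed.

End charge_integral.

(** * Closure under bounded pointwise limits *)

Section smooth_sign.
Context (R : realType).
Implicit Types t : R.

(** The Newton-Schulz iteration for the sign: an odd cubic with fixed points -1, 0, 1 whose
    derivative vanishes at -1 and 1. *)
Definition sign_step t : R := t * (3 - t * t) / 2.

Lemma iter_sign_stepN n t : iter n sign_step (- t) = - iter n sign_step t.
Proof. by elim: n => //= n ->; rewrite /sign_step; ring. Qed.

(** The iterates increase from [t] towards 1. That they stay above [t] is kept in the induction
    because it makes the contraction factor uniform. *)
Lemma iter_sign_step_bounds n t : 0 <= t <= 1 ->
  t <= iter n sign_step t <= 1 /\ 1 - iter n sign_step t <= (1 - t / 2) ^+ n.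
Proof.
move=> /andP[t0 t1]; elim: n => [|n [/andP[tu u1] ih]] /=.
  by rewrite lexx t1 expr0; split => //; lra.
set u := iter n sign_step t in tu u1 ih *.
have u0 : 0 <= u by exact: le_trans tu.
have e : 1 - sign_step u = (1 - u) * ((1 - u) * (2 + u) / 2).
  by rewrite /sign_step; field.
have uu : u <= sign_step u.
  rewrite -subr_ge0 (_ : _ - _ = u * ((1 - u) * (1 + u)) / 2); last first.
    by rewrite /sign_step; field.
  by rewrite !mulr_ge0 ?subr_ge0 ?addr_ge0.
split.
  rewrite (le_trans tu uu)/= -subr_ge0 e !mulr_ge0 ?subr_ge0 ?addr_ge0//.
rewrite e exprSr ler_pM ?subr_ge0 ?mulr_ge0 ?subr_ge0 ?addr_ge0//.
(* The factor equals 1 - (u + u^2) / 2, which is at most 1 - t / 2 since u >= t >= 0. *)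
nra.
Qed.

Lemma iter_sign_step_le1 n t : `|t| <= 1 -> `|iter n sign_step t| <= 1.
Proof.
wlog t0 : t / 0 <= t => [h|].
  have [/h//|/ltW t0] := leP 0 t; rewrite -normrN => /h.
  by rewrite oppr_ge0 iter_sign_stepN normrN; apply.
rewrite (ger0_norm t0) => t1.
have [] := @iter_sign_step_bounds n t; first by rewrite t0.
move=> /andP[tu u1] _; rewrite ger0_norm//; exact: le_trans tu.
Qed.

Lemma cvg_iter_sign_step t : `|t| <= 1 ->
  iter n sign_step t @[n --> \oo] --> Num.sg t.
Proof.
wlog t0 : t / 0 <= t => [h|].
  have [/h//|t0] := leP 0 t; rewrite -normrN => /h.
  rewrite oppr_ge0 (ltW t0) => /(_ isT) /cvgN.
  rewrite sgrN opprK.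
  rewrite (_ : (fun n => iter n _ t) = - (fun n => iter n sign_step (- t)))//.
  by apply/funext => n; rewrite [RHS]/GRing.opp/= iter_sign_stepN opprK.
rewrite (ger0_norm t0) => t1; have [<-|tn0] := eqVneq 0 t.
  rewrite sgr0; rewrite (_ : (fun n => _) = fun _ => 0); first exact: cvg_cst.
  by apply/funext; elim=> //= n ->; rewrite /sign_step !mul0r.
have tp : 0 < t by rewrite lt_neqAle tn0.
rewrite gtr0_sg//.
have b n := @iter_sign_step_bounds n t.
apply: (@squeeze_cvgr _ _ _ _ (fun n => 1 - (1 - t / 2) ^+ n) (fun _ => 1)).
- apply: nearW => n; have [] := b n; first by rewrite t0.
  by move=> /andP[_ ->]; rewrite andbT lerBlDr addrC -lerBlDr.
- rewrite -[X in _ --> X]subr0; apply: cvgB; first exact: cvg_cst.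
  apply: cvg_expr; rewrite ger0_norm; lra.
- exact: cvg_cst.
Qed.

End smooth_sign.

(** * The closure of an algebra of bounded functions and its indicators *)

Section bounded_closure.
Context (T : Type) (R : realType).
Implicit Types (f g : T -> R) (A : set T).

(** Only operations respected by an integral are constructors; stability under products is derived
    from the products of generators. *)
Inductive bounded_closure (G : set (T -> R)) : (T -> R) -> Prop :=
| bclosure_gen f : G f -> bounded_closure G f
| bclosure_linear (a : R) f g : bounded_closure G f -> bounded_closure G g ->
    bounded_closure G (fun x => a * f x + g x)
| bclosure_cvg (u : nat -> T -> R) f (M : R) :
    (forall n, bounded_closure G (u n)) -> (forall n x, `|u n x| <= M) ->
    (forall x, u n x @[n --> \oo] --> f x) -> bounded_closure G f.

Variable G : set (T -> R).
Hypothesis G1 : G (fun _ => 1).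
Hypothesis Gbnd : forall g, G g -> exists M, forall x, `|g x| <= M.
Hypothesis GM : forall f g, G f -> G g -> bounded_closure G (fun x => f x * g x).

Local Notation bc := (bounded_closure G).

Lemma bclosure_bounded f : bc f -> exists M, forall x, `|f x| <= M.
Proof.
elim=> [g /Gbnd//|a g h _ [M gM] _ [N hN]|u g M _ _ uM ug].
  exists (`|a| * M + N) => x; apply: le_trans (ler_normD _ _) _.
  by rewrite lerD// normrM ler_wpM2l.
exists M => x; have /cvg_norm cx := ug x.
rewrite -(cvg_lim _ cx)//; apply: limr_le; first by apply/cvg_ex; exists `|g x|.
by apply: nearW => n; exact: uM.
Qed.

Lemma bclosure0 : bc (fun _ => 0).
Proof.
have h := bclosure_linear (-1) (bclosure_gen G1) (bclosure_gen G1).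
by rewrite mulN1r addNr in h.
Qed.

Lemma bclosureD f g : bc f -> bc g -> bc (fun x => f x + g x).
Proof.
move=> bf bg; rewrite (_ : (fun _ => _) = fun x => 1 * f x + g x).
  exact: bclosure_linear.
by apply/funext => x; rewrite mul1r.
Qed.

Lemma bclosureZ a f : bc f -> bc (fun x => a * f x).
Proof.
move=> bf; rewrite (_ : (fun _ => _) = fun x => a * f x + 0).
  by apply: bclosure_linear => //; exact: bclosure0.
by apply/funext => x; rewrite addr0.
Qed.

Lemma bclosure_cst a : bc (fun _ => a).
Proof.
by have := bclosureZ a (bclosure_gen G1); rewrite mulr1.
Qed.

(** Induction on one factor at a time: [step] fixes a bounded factor and passes from generators to
    the closure in the other. Using it twice reduces the claim to products of two generators. *)
Lemma bclosureM f g : bc f -> bc g -> bc (fun x => f x * g x).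
Proof.
have step (h : T -> R) : (exists N, forall x, `|h x| <= N) ->
    (forall e, G e -> bc (fun x => e x * h x)) ->
    forall e, bc e -> bc (fun x => e x * h x).
  move=> [N hN] Gh e; elim=> [e' /Gh//|a e1 e2 _ b1 _ b2|u e' M _ bu uM ue].
    rewrite (_ : (fun _ => _) = fun x => a * (e1 x * h x) + e2 x * h x).
      exact: bclosure_linear.
    by apply/funext => x; ring.
  apply: (@bclosure_cvg _ (fun n x => u n x * h x) _ (M * N)) => // [n x|x].
    by rewrite normrM ler_pM.
  by apply: cvgMr_tmp; exact: ue.
move=> bf bg; move: f bf; apply: (step g); first exact: bclosure_bounded.
move=> e Ge; rewrite (_ : (fun _ => _) = fun x => g x * e x); last first.
  by apply/funext => x; rewrite mulrC.
move: g bg; apply: (step e); first exact: Gbnd.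
by move=> h Gh; exact: GM.
Qed.

Lemma bclosure_sg f : bc f -> bc (fun x => Num.sg (f x)).
Proof.
move=> bf; have [M fM] := bclosure_bounded bf.
(* Rescaling brings the values into [-1, 1], where the iteration converges, and keeps their signs;
   the added 1 makes the inverse positive for every [M]. *)
pose c := (`|M| + 1)^-1.
have c0 : 0 < c by rewrite invr_gt0 ltr_wpDl.
have fc x : `|c * f x| <= 1.
  rewrite normrM gtr0_norm// mulrC ler_pdivrMr ?ltr_wpDl// mul1r.
  by rewrite (le_trans (fM x))// (le_trans (ler_norm _))// lerDl.
apply: (@bclosure_cvg _ (fun n x => iter n (@sign_step R) (c * f x)) _ 1).
- elim=> [|n ih] /=; first exact: bclosureZ.
  rewrite (_ : (fun _ => _) = fun x => 3 / 2 * iter n (@sign_step R) (c * f x)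
      + (- (1 / 2)) * (iter n (@sign_step R) (c * f x) *
          (iter n (@sign_step R) (c * f x) * iter n (@sign_step R) (c * f x)))).
    by apply: bclosure_linear => //; apply: bclosureZ; do !apply: bclosureM.
  by apply/funext => x; rewrite /sign_step; field.
- by move=> n x; exact: iter_sign_step_le1.
- move=> x; have := cvg_iter_sign_step (fc x).
  by rewrite sgrM (gtr0_sg c0) mul1r.
Qed.

Lemma bclosure_gt0 f : bc f -> bc (\1_[set x | 0 < f x]).
Proof.
move=> /bclosure_sg bf.
(* The polynomial s (s + 1) / 2 is 1 at s = 1 and 0 at s = 0 and s = -1. *)
rewrite (_ : \1__ = fun x => 1 / 2 * (Num.sg (f x) * (Num.sg (f x) + 1))).
  apply: bclosureZ; apply: bclosureM => //; apply: bclosureD => //.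
  exact: bclosure_cst.
apply/funext => x; rewrite indicE; case: (sgrP (f x)) => [fx|fx|fx].
- by rewrite memNset ?mul0r ?mulr0//= fx ltxx.
- by rewrite mem_set//=; field.
- by rewrite memNset/= ?addNr ?mulr0// ltNge (ltW fx).
Qed.

Lemma bclosure_setC A : bc \1_A -> bc \1_(~` A).
Proof.
move=> bA; rewrite (_ : \1__ = fun x => -1 * \1_A x + 1).
  by apply: bclosure_linear => //; exact: bclosure_cst.
by apply/funext => x; rewrite !indicE in_setC; case: (x \in A) => /=; ring.
Qed.

Lemma bclosure_setI A B : bc \1_A -> bc \1_B -> bc \1_(A `&` B).
Proof.
move=> bA bB; rewrite (_ : \1__ = fun x => \1_A x * \1_B x).
  exact: bclosureM.
apply/funext => x; rewrite !indicE in_setI.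
by case: (x \in A); rewrite ?mul1r ?mul0r.
Qed.

Lemma bclosure_setU A B : bc \1_A -> bc \1_B -> bc \1_(A `|` B).
Proof.
move=> bA bB; rewrite -[A `|` B]setCK setCU.
by apply/bclosure_setC/bclosure_setI; exact: bclosure_setC.
Qed.

(** At each point the indicators of the finite partial unions are eventually constant, and they are
    bounded by 1. *)
Lemma bclosure_bigcup (F : (set T)^nat) : (forall n, bc \1_(F n)) ->
  bc \1_(\bigcup_n F n).
Proof.
move=> bF; pose U n := \big[setU/set0]_(i < n) F i.
apply: (@bclosure_cvg _ (fun n => \1_(U n)) _ 1).
- elim=> [|n ih]; rewrite /U; first by rewrite big_ord0 indic0; exact: bclosure0.
  by rewrite big_ord_recr; exact: bclosure_setU.
- by move=> n x; rewrite indicE; case: (x \in _); rewrite ?normr0 ?normr1.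
- move=> x; have [Fx|nFx] := pselect ((\bigcup_n F n) x).
    rewrite indicE mem_set//; have [k _ Fk] := Fx.
    apply: cvg_near_cst; exists k.+1 => // n /= kn; rewrite indicE mem_set//.
    by rewrite /U -bigcup_mkord; exists k.
  rewrite indicE memNset//; apply: cvg_near_cst; apply: nearW => n.
  rewrite indicE memNset// /U -bigcup_mkord => -[k _ Fk].
  by apply: nFx; exists k.
Qed.

Lemma bclosure_sigma_algebra : sigma_algebra setT [set A | bc \1_A].
Proof.
split => /=.
- by rewrite indic0; exact: bclosure0.
- by move=> A bA; rewrite setTD; exact: bclosure_setC.
- exact: bclosure_bigcup.
Qed.

End bounded_closure.

(** Measurability and boundedness are carried through the induction together with the equality,
    since linearity and the limit rule presuppose them. *)
Lemma bclosure_integral_eq d (T : measurableType d) (R : realType)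
    (G : set (T -> R)) (L K : (T -> R) -> R) :
  integral_like L -> integral_like K ->
  (forall g, G g -> bounded_measurable g /\ L g = K g) ->
  forall f, bounded_closure G f -> L f = K f.
Proof.
move=> Lil Kil GLK f bf; suff [] : bounded_measurable f /\ L f = K f by [].
elim: bf => [g /GLK//|a g h _ [bg LKg] _ [bh LKh]|u g M _ ih uM ug].
  split; last by rewrite !il_linear// LKg LKh.
  by apply: bounded_measurableD => //; exact: bounded_measurableZ.
have mu n := (ih n).1.1; split; first exact: bounded_measurable_cvg ug.
apply: (cvg_unique _ (il_cvg Lil mu uM ug)) => //.
rewrite (_ : (fun n => _) = fun n => K (u n)); first exact: (il_cvg Kil mu uM ug).
by apply/funext => n; have [] := ih n.
Qed.

(** * Trigonometric waves on the torus *)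

Section characters.
Context {R : realType} {d : nat}.
Implicit Types (k : 'I_d -> int) (x y : torus R d).

Definition phase k x : R := \sum_(i < d) 2 * pi * (k i)%:~R * cval (tnth x i).

Lemma phaseD k l x : phase (fun i => k i + l i) x = phase k x + phase l x.
Proof.
by rewrite /phase -big_split/=; apply: eq_bigr => i _; rewrite intrD; ring.
Qed.

Lemma phaseN k x : phase (fun i => - k i) x = - phase k x.
Proof.
by rewrite /phase -sumrN; apply: eq_bigr => i _; rewrite intrN; ring.
Qed.

Lemma phaseB k l x : phase (fun i => k i - l i) x = phase k x - phase l x.
Proof. by rewrite phaseD phaseN. Qed.

Lemma phase0 x : phase (fun=> 0) x = 0.
Proof. by rewrite /phase big1// => i _; rewrite mulr0 mul0r. Qed.

Lemma measurable_cval : measurable_fun setT (@cval R : circle R -> measurableTypeR R).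
Proof. by move=> _ B mB; exists B. Qed.

Lemma measurable_phase k : measurable_fun setT (phase k : torus R d -> R).
Proof.
apply: measurable_sum => i; apply: measurable_funM; first exact: measurable_cst.
exact: (measurableT_comp measurable_cval (measurable_tnth i)).
Qed.

Lemma bounded_measurable_cos_phase k : bounded_measurable (fun x => cos (phase k x)).
Proof.
split; last by exists 1 => x; exact: cos_max.
apply: measurableT_comp (measurable_phase k).
by apply: continuous_measurable_fun; exact: continuous_cos.
Qed.

Lemma bounded_measurable_sin_phase k : bounded_measurable (fun x => sin (phase k x)).
Proof.
split; last by exists 1 => x; exact: sin_max.
apply: measurableT_comp (measurable_phase k).
by apply: continuous_measurable_fun; exact: continuous_sin.
Qed.

(** Real waves take the place of complex characters because charges are integrated against real
    functions. *)
Inductive trig_wave : (torus R d -> R) -> Prop :=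
| trig_cos k : trig_wave (fun x => cos (phase k x))
| trig_sin k : trig_wave (fun x => sin (phase k x)).

Lemma trig_wave1 : trig_wave (fun=> 1).
Proof.
rewrite (_ : (fun=> 1) = fun x => cos (phase (fun=> 0) x)); first exact: trig_cos.
by apply/funext => x; rewrite phase0 cos0.
Qed.

Lemma trig_wave_bounded f : trig_wave f -> exists M, forall x, `|f x| <= M.
Proof.
by case=> k; [have [] := bounded_measurable_cos_phase k|
              have [] := bounded_measurable_sin_phase k].
Qed.

(** Product-to-sum formulas: each product is a half-sum or half-difference of waves at the
    frequencies [k + l] and [k - l]. *)
Lemma trig_waveM f g : trig_wave f -> trig_wave g ->
  bounded_closure trig_wave (fun x => f x * g x).
Proof.
have half (a b : R) u v w : trig_wave u -> trig_wave v ->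
    (forall x, w x = a * u x + b * v x) -> bounded_closure trig_wave w.
  move=> wu wv uvw; rewrite (_ : w = fun x => a * u x + b * v x).
    apply: bclosure_linear; first exact: bclosure_gen.
    by apply: bclosureZ; [exact: trig_wave1|exact: bclosure_gen].
  by apply/funext.
case=> k [] l.
- apply: (half (1/2) (1/2) _ _ _ (trig_cos (fun i => k i - l i))
           (trig_cos (fun i => k i + l i))) => x.
  by rewrite phaseB phaseD cosB cosD; field.
- apply: (half (1/2) (-(1/2)) _ _ _ (trig_sin (fun i => k i + l i))
           (trig_sin (fun i => k i - l i))) => x.
  by rewrite phaseB phaseD sinB sinD; field.
- apply: (half (1/2) (1/2) _ _ _ (trig_sin (fun i => k i + l i))
           (trig_sin (fun i => k i - l i))) => x.
  by rewrite phaseB phaseD sinB sinD; field.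
- apply: (half (1/2) (-(1/2)) _ _ _ (trig_cos (fun i => k i - l i))
           (trig_cos (fun i => k i + l i))) => x.
  by rewrite phaseB phaseD cosB cosD; field.
Qed.

Local Notation bc := (bounded_closure trig_wave).

(** The sign of the sine tells in which half of the circle [t] lies, and on each half the cosine is
    monotone. A ray thus becomes a union or an intersection of sets cut out by waves. *)
Lemma gt_itv01_trig (a t : R) : 0 <= a < 1 -> 0 <= t < 1 ->
  (a < t) = if a < 1 / 2
    then (sin (2 * pi * t) < 0) || (cos (2 * pi * t) < cos (2 * pi * a))
    else (sin (2 * pi * t) < 0) && (cos (2 * pi * a) < cos (2 * pi * t)).
Proof.
have p0 := pi_gt0 R.
have p20 : 0 < 2 * pi :> R by rewrite mulr_gt0.
(* Reflection carries [1/2, 1) into (0, 1/2], where the cosine decreases. *)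
have refl (u : R) : cos (2 * pi * (1 - u)) = cos (2 * pi * u).
  rewrite (_ : 2 * pi * (1 - u) = - (2 * pi * u) + pi *+ 2); last by ring.
  by rewrite cosD2pi cosN.
have cosmono (u v : R) : 0 <= u <= 1 / 2 -> 0 <= v <= 1 / 2 ->
    (cos (2 * pi * u) < cos (2 * pi * v)) = (v < u).
  move=> /andP[u0 u1] /andP[v0 v1]; rewrite ltr_cos ?ltr_pM2l// in_itv/=.
    by apply/andP; split; nra.
  by apply/andP; split; nra.
have sinneg (u : R) : 0 <= u < 1 -> (sin (2 * pi * u) < 0) = (1 / 2 < u).
  move=> /andP[u0 u1]; have [uh|uh] := leP u (1 / 2).
    by apply/negbTE; rewrite -leNgt sin_ge0_pi//; apply/andP; split; nra.
  rewrite -oppr_gt0 -sinN -sinD2pi sin_gt0_pi// mulr2n.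
  by apply/andP; split; nra.
move=> a01 t01; rewrite sinneg//.
move: a01 t01 => /andP[a0 a1] /andP[t0 t1].
have [ah|ah] := ltP a (1 / 2); have [th|th] := leP t (1 / 2) => /=.
- by rewrite cosmono// ?a0 ?t0 ?(ltW ah).
- by rewrite (lt_trans ah th).
- by apply/negbTE; rewrite -leNgt (le_trans th).
- by rewrite -(refl a) -(refl t) cosmono ?ltrD2l ?ltrN2//; apply/andP; split; lra.
Qed.

Lemma bclosure_coordinate_gt (i : 'I_d) (a : R) :
  bc \1_[set x | a < cval (tnth x i)].
Proof.
have b1 := trig_wave1; have bb := trig_wave_bounded; have bM := trig_waveM.
have c01 x : 0 <= cval (tnth x i) < 1 by case: (tnth x i).
have [a0|a0] := ltP a 0.
  rewrite (_ : [set _ | _] = setT); first by rewrite indicT; exact: bclosure_gen.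
  by apply/seteqP; split => // x _ /=; case/andP: (c01 x) => + _; exact: lt_le_trans.
have [a1|a1] := ltP a 1; last first.
  rewrite (_ : [set _ | _] = set0); first by rewrite indic0; exact: bclosure0.
  apply/seteqP; split => // x /= ax; case/andP: (c01 x) => _.
  by move=> /(lt_trans ax); rewrite ltNge a1.
(* The unit frequency in direction [i], whose phase sees only the coordinate [i]. *)
pose e j : int := (j == i)%:R.
have phe x : phase e x = 2 * pi * cval (tnth x i).
  rewrite /phase (bigD1 i)//= big1 ?addr0 ?/e ?eqxx ?mulr1// => j /negbTE ->.
  by rewrite mulr0 mul0r.
have bs : bc (fun x => sin (phase e x)) by apply: bclosure_gen; exact: trig_sin.
have bcos : bc (fun x => cos (phase e x)) by apply: bclosure_gen; exact: trig_cos.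
have bsneg : bc \1_[set x | 0 < -1 * sin (phase e x)].
  by apply: bclosure_gt0 => //; exact: bclosureZ.
have bclt : bc \1_[set x | 0 < -1 * cos (phase e x) + cos (2 * pi * a)].
  apply: bclosure_gt0 => //; apply: bclosure_linear => //; exact: bclosure_cst.
have bcgt : bc \1_[set x | 0 < 1 * cos (phase e x) + - cos (2 * pi * a)].
  apply: bclosure_gt0 => //; apply: bclosure_linear => //; exact: bclosure_cst.
have aE x := @gt_itv01_trig a (cval (tnth x i)) (introT andP (conj a0 a1)) (c01 x).
have [ah|ah] := ltP a (1 / 2).
  rewrite (_ : [set _ | _] = [set x | 0 < -1 * sin (phase e x)] `|`
      [set x | 0 < -1 * cos (phase e x) + cos (2 * pi * a)]).
    exact: bclosure_setU.
  apply/seteqP; split => x /=; rewrite aE ah phe !mulN1r oppr_gt0 addrC subr_gt0;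
  by move/orP.
rewrite (_ : [set _ | _] = [set x | 0 < -1 * sin (phase e x)] `&`
    [set x | 0 < 1 * cos (phase e x) + - cos (2 * pi * a)]).
  exact: bclosure_setI.
apply/seteqP; split => x /=; rewrite aE (le_gtF ah) phe mulN1r mul1r oppr_gt0 subr_gt0;
by move/andP.
Qed.

Lemma bclosure_measurable (A : set (torus R d)) : measurable A -> bc \1_A.
Proof.
have b1 := trig_wave1; have bb := trig_wave_bounded; have bM := trig_waveM.
have [D0 DC DU] := bclosure_sigma_algebra b1 bb bM.
suff : measurable `<=` [set A : set (torus R d) | bc \1_A] by apply.
apply: smallest_sub; first exact: bclosure_sigma_algebra.
(* The product sigma-algebra is generated by preimages of Borel sets under the coordinates; for a
   fixed coordinate, open rays generate these Borel sets. *)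
rewrite -bigcup_seq; apply: bigcup_sub => i _ _ [_ [B mB <-] <-].
rewrite !setTI.
suff : (@RGenOInfty.G R).-sigma.-measurable `<=`
    [set B : set R | bc \1_((fun x => cval (tnth x i)) @^-1` B)].
  by rewrite -RGenOInfty.measurableE; apply.
apply: smallest_sub; last first.
  move=> _ [a ->] /=; rewrite preimage_itvoy; exact: bclosure_coordinate_gt.
split => [|C bC|F bF] /=.
- by rewrite preimage_set0.
- by rewrite setTD preimage_setC; rewrite -[~` _]setTD; exact: DC.
- by rewrite preimage_bigcup; exact: DU.
Qed.

End characters.

(** * Integrals against complex measures *)

Lemma charge_fourier_unique (R : realType) (d : nat)
    (nu1 nu2 : {charge set (torus R d) -> \bar R}) :
  (forall k : 'I_d -> int,
    charge_integral nu1 (fun x => cos (phase k x)) =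
      charge_integral nu2 (fun x => cos (phase k x)) /\
    charge_integral nu1 (fun x => sin (phase k x)) =
      charge_integral nu2 (fun x => sin (phase k x))) ->
  forall A, measurable A -> nu1 A = nu2 A.
Proof.
move=> nu12 A mA.
rewrite -[LHS]fineK ?fin_num_measure// -[RHS]fineK ?fin_num_measure//.
rewrite -!charge_integral_indic//; congr (_%:E).
apply: bclosure_integral_eq (bclosure_measurable mA).
- exact: integral_like_charge.
- exact: integral_like_charge.
- move=> _ [] k; have [ec es] := nu12 k; split => //.
    exact: bounded_measurable_cos_phase.
  exact: bounded_measurable_sin_phase.
Qed.

Section complex_integral.
Context d (T : measurableType d) (R : realType).
Local Open Scope complex_scope.
Local Notation Re := complex.Re.
Local Notation Im := complex.Im.
Implicit Types (F G : T -> R[i]) (mu nu : complex_measure T R).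

Definition cbounded_measurable F :=
  bounded_measurable (fun x => Re (F x)) /\ bounded_measurable (fun x => Im (F x)).

Lemma ReM (a b : R[i]) : Re (a * b) = Re a * Re b - Im a * Im b.
Proof. by case: a; case: b. Qed.

Lemma ImM (a b : R[i]) : Im (a * b) = Re a * Im b + Im a * Re b.
Proof. by case: a; case: b. Qed.

Lemma eq_ReIm (a b : R[i]) : Re a = Re b -> Im a = Im b -> a = b.
Proof. by case: a => ? ?; case: b => ? ? /= -> ->. Qed.

Lemma cbounded_measurable_cst (a : R[i]) : cbounded_measurable (fun=> a).
Proof. by split; exact: bounded_measurable_cst. Qed.

Lemma cbounded_measurableD F G : cbounded_measurable F -> cbounded_measurable G ->
  cbounded_measurable (fun x => F x + G x).
Proof.
by move=> [Fr Fi] [Gr Gi]; split; under eq_fun do rewrite raddfD/=;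
  exact: bounded_measurableD.
Qed.

Lemma cbounded_measurableM F G : cbounded_measurable F -> cbounded_measurable G ->
  cbounded_measurable (fun x => F x * G x).
Proof.
move=> [Fr Fi] [Gr Gi]; split.
  under eq_fun do rewrite ReM.
  by apply: bounded_measurableB; exact: bounded_measurableM.
under eq_fun do rewrite ImM.
by apply: bounded_measurableD; exact: bounded_measurableM.
Qed.

Lemma cbounded_measurable_sum (I : Type) (s : seq I) (F : I -> T -> R[i]) :
  (forall i, cbounded_measurable (F i)) ->
  cbounded_measurable (fun x => \sum_(i <- s) F i x).
Proof.
move=> bF; elim: s => [|i s ih].
  by under eq_fun do rewrite big_nil; exact: cbounded_measurable_cst.
by under eq_fun do rewrite big_cons; exact: cbounded_measurableD.
Qed.

Lemma cm_integralD mu F G : cbounded_measurable F -> cbounded_measurable G ->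
  cm_integral mu (fun x => F x + G x) = cm_integral mu F + cm_integral mu G.
Proof.
move=> [Fr Fi] [Gr Gi].
have il rho := @integral_like_charge _ T R rho.
have D rho := ilD (il rho).
apply: eq_ReIm; rewrite raddfD/=.
- under eq_fun do rewrite raddfD/=.
  under [X in _ - charge_integral _ X = _]eq_fun do rewrite raddfD/=.
  by rewrite !D//; ring.
- under eq_fun do rewrite raddfD/=.
  under [X in _ + charge_integral _ X = _]eq_fun do rewrite raddfD/=.
  by rewrite !D//; ring.
Qed.

Lemma cm_integralZ mu (a : R[i]) F : cbounded_measurable F ->
  cm_integral mu (fun x => a * F x) = a * cm_integral mu F.
Proof.
move=> [Fr Fi].
have il rho := @integral_like_charge _ T R rho.
have reE rho : charge_integral rho (fun x => Re (a * F x)) =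
    Re a * charge_integral rho (fun x => Re (F x)) -
    Im a * charge_integral rho (fun x => Im (F x)).
  under eq_fun do rewrite ReM.
  by rewrite (ilB (il rho)) ?(ilZ (il rho))//; exact: bounded_measurableZ.
have imE rho : charge_integral rho (fun x => Im (a * F x)) =
    Re a * charge_integral rho (fun x => Im (F x)) +
    Im a * charge_integral rho (fun x => Re (F x)).
  under eq_fun do rewrite ImM.
  by rewrite (ilD (il rho)) ?(ilZ (il rho))//; exact: bounded_measurableZ.
by apply: eq_ReIm; rewrite ?ReM ?ImM/= !reE !imE; ring.
Qed.

Lemma cm_integral_sum mu (I : Type) (s : seq I) (F : I -> T -> R[i]) :
  (forall i, cbounded_measurable (F i)) ->
  cm_integral mu (fun x => \sum_(i <- s) F i x) = \sum_(i <- s) cm_integral mu (F i).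
Proof.
move=> bF; elim: s => [|i s ih].
  rewrite big_nil -[RHS](mul0r (cm_integral mu (fun=> 0))).
  rewrite -cm_integralZ; last exact: cbounded_measurable_cst.
  by congr cm_integral; apply/funext => x; rewrite big_nil mul0r.
rewrite big_cons -ih -cm_integralD//; last exact: cbounded_measurable_sum.
by congr cm_integral; apply/funext => x; rewrite big_cons.
Qed.

(** The parts of the assembled measure have the same values as [a] and [b] but are distinct charges
    with their own chosen Hahn decompositions, hence the detour through [charge_integral_eq]. *)
Lemma cm_integral_of_charges (a b : {charge set T -> \bar R}) F :
  cbounded_measurable F -> cm_integral (cm_of_charges a b) F =
    (charge_integral a (fun x => Re (F x)) - charge_integral b (fun x => Im (F x))) +i*
    (charge_integral b (fun x => Re (F x)) + charge_integral a (fun x => Im (F x))).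
Proof.
move=> [Fr Fi].
have aE f : bounded_measurable f ->
    charge_integral (cm_Re (cm_of_charges a b)) f = charge_integral a f.
  apply: charge_integral_eq; first exact: integral_like_charge.
  by move=> A mA; rewrite charge_integral_indic.
have bE f : bounded_measurable f ->
    charge_integral (cm_Im (cm_of_charges a b)) f = charge_integral b f.
  apply: charge_integral_eq; first exact: integral_like_charge.
  by move=> A mA; rewrite charge_integral_indic.
by rewrite /cm_integral !aE// !bE.
Qed.

Lemma cm_integral_sub nu mu F : cbounded_measurable F ->
  cm_integral (cm_sub nu mu) F = cm_integral nu F - cm_integral mu F.
Proof.
move=> bF; have [Fr Fi] := bF; rewrite cm_integral_of_charges//.
rewrite !charge_integral_cadd// !charge_integral_copp//.
by apply: eq_ReIm => /=; ring.
Qed.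

Lemma cm_integral_measure (m : {finite_measure set T -> \bar R}) F :
  cbounded_measurable F -> cm_integral (cm_of_measure m) F =
    (\int[m]_x Re (F x)) +i* (\int[m]_x Im (F x)).
Proof.
move=> bF; have [Fr Fi] := bF; rewrite cm_integral_of_charges//.
have z f : bounded_measurable f ->
    charge_integral (czero : {charge set T -> \bar R}) f = 0.
  apply: (@charge_integral_eq _ _ _ _ (fun=> 0)).
    by split=> [*|*]; [rewrite mulr0 addr0|exact: cvg_cst].
  by [].
by rewrite !z// subr0 add0r !charge_integral_measure.
Qed.

Lemma cm_integral_density (m : {finite_measure set T -> \bar R}) (p F : T -> R[i]) :
  cbounded_measurable p -> cbounded_measurable F ->
  cm_integral (cm_density m p) F = cm_integral (cm_of_measure m) (fun x => F x * p x).
Proof.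
move=> bp bF; have [pr pi] := bp; have [Fr Fi] := bF.
rewrite cm_integral_measure; last exact: cbounded_measurableM.
have ir := bounded_measurable_integrable m pr.
have ii := bounded_measurable_integrable m pi.
(* Bounded parts are integrable, which excludes the default value of [cm_density]. *)
rewrite /cm_density; case: pselect => [intRe|/(_ ir)//].
case: pselect => [intIm|/(_ ii)//].
rewrite cm_integral_of_charges// !charge_integral_induced//.
have iM f g : bounded_measurable f -> bounded_measurable g ->
    m.-integrable setT (EFin \o (fun x => f x * g x)).
  by move=> bf bg; apply/bounded_measurable_integrable/bounded_measurableM.
apply: eq_ReIm => /=.
- by rewrite -RintegralB//; [under [RHS]eq_Rintegral do rewrite ReM|exact: iM|exact: iM].
- by rewrite -RintegralD//; [under [RHS]eq_Rintegral do rewrite ImM|exact: iM|exact: iM].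
Qed.

End complex_integral.

(** * Orthogonality of the characters *)

Section periodicity.
Context {R : realType}.

Lemma cosD2piz (t : R) (k : int) : cos (t + 2 * pi * k%:~R) = cos t.
Proof.
have pos (n : nat) (u : R) : cos (u + 2 * pi * n%:~R) = cos u.
  have -> : 2 * pi * n%:~R = (pi *+ 2) *+ n :> R.
    by rewrite -pmulrn mulr_natr mulr_natl.
  exact: periodicn (@cosD2pi R) n u.
case: k => n; first exact: pos.
by rewrite -[LHS](pos n.+1) NegzE; congr cos; rewrite intrN; ring.
Qed.

Lemma sinD2piz (t : R) (k : int) : sin (t + 2 * pi * k%:~R) = sin t.
Proof. by rewrite -!cosBpihalf addrAC cosD2piz. Qed.

End periodicity.

Section orthogonality.
Context {R : realType}.

(** The measure on the circle is transported to Lebesgue measure on [0, 1), where the fundamental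
    theorem of calculus gives F 1 - F 0. *)
Lemma circle_integral_derivative (F f : R -> R) : (forall x : R, is_derive x 1 F (f x)) ->
  continuous f -> (exists M, forall x, `|f x| <= M) -> F 1 = F 0 ->
  \int[@circle_lebesgue R]_x f (cval x) = 0.
Proof.
move=> dF cf [M fM] F10.
have mf : measurable_fun setT f by exact: continuous_measurable_fun.
have mc := @measurable_cval R.
set m := pushforward (@circle_lebesgue R) (@cval R : _ -> measurableTypeR R).
have pE : (\int[m]_(y in `[0%R, 1%R[) (f y)%:E = \int[@circle_lebesgue R]_x (f (cval x))%:E)%E.
  have cT : (@cval R : circle R -> measurableTypeR R) @^-1` `[0, 1[ = setT.
    by apply/seteqP; split => // -[x x01] _ /=; rewrite in_itv.
  rewrite (@integral_pushforward _ _ _ (measurableTypeR R) _ _ mc)//= ?cT//.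
    exact/measurable_EFinP.
  apply: bounded_measurable_integrable; split; last by exists M.
  exact: (measurableT_comp mf mc).
have lE : (\int[m]_(y in `[0%R, 1%R[) (f y)%:E = \int[lebesgue_measure]_(y in `[0%R, 1%R[) (f y)%:E)%E.
  apply: eq_measure_integral => A mA A01; congr lebesgue_measure.
  apply/seteqP; split => [_ [x /= Ax <-]//|y Ay].
  have := A01 _ Ay; rewrite /= in_itv/= => y01.
  by exists (Circle y01).
(* The endpoint 1 is a null set, so the interval can be closed. *)
rewrite /Rintegral -pE lE integral_itv_bndo_bndc; last first.
  by apply/measurable_funTS/measurable_EFinP.
have cF : continuous F.
  by move=> x; apply/differentiable_continuous/derivable1_diffP; exact: ex_derive.
rewrite (@continuous_FTC2 _ _ F)//.
- by rewrite F10 subee.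
- exact: continuous_subspaceT.
- split=> [x _||]; first exact: ex_derive.
    by apply: cvg_at_right_filter; exact: cF.
  by apply: cvg_at_left_filter; exact: cF.
- by move=> x _; rewrite derive1E derive_val.
Qed.

Lemma circle_integral_wave (k : int) : k != 0 ->
  \int[@circle_lebesgue R]_x cos (2 * pi * k%:~R * cval x) = 0 /\
  \int[@circle_lebesgue R]_x sin (2 * pi * k%:~R * cval x) = 0.
Proof.
move=> k0; set c : R := 2 * pi * k%:~R.
have c0 : c != 0 by rewrite !mulf_neq0// ?intr_eq0// gt_eqF// pi_gt0.
have ccos : continuous (fun t : R => cos (c * t)).
  move=> t; apply: (@continuous_comp _ _ _ ( *%R c)); last exact: continuous_cos.
  exact: mulrl_continuous.
have csin : continuous (fun t : R => sin (c * t)).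
  move=> t; apply: (@continuous_comp _ _ _ ( *%R c)); last exact: continuous_sin.
  exact: mulrl_continuous.
split.
- apply: (@circle_integral_derivative (fun t => c^-1 * sin (c * t))
    (fun t => cos (c * t))) => //.
  + move=> t; apply: is_derive_eq.
    by rewrite /GRing.scale/=; field.
  + by exists 1 => t; exact: cos_max.
  + by rewrite mulr0 mulr1 -(sinD2piz 0 k) add0r.
- apply: (@circle_integral_derivative (fun t => - c^-1 * cos (c * t))
    (fun t => sin (c * t))) => //.
  + move=> t; apply: is_derive_eq.
    by rewrite /GRing.scale/=; field.
  + by exists 1 => t; exact: sin_max.
  + by rewrite mulr0 mulr1 -(cosD2piz 0 k) add0r.
Qed.

Lemma bounded_measurable_tensor d1 d2 (T1 : measurableType d1) (T2 : measurableType d2)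
    (u : T1 -> R) (v : T2 -> R) :
  bounded_measurable u -> bounded_measurable v ->
  bounded_measurable (fun p : T1 * T2 => u p.1 * v p.2).
Proof.
move=> [mu [M uM]] [mv [N vN]]; apply: bounded_measurableM; split.
- exact: measurableT_comp.
- by exists M.
- exact: measurableT_comp.
- by exists N.
Qed.

Lemma product_Rintegral d1 d2 (T1 : measurableType d1) (T2 : measurableType d2)
    (m1 : probability T1 R) (m2 : probability T2 R) (u : T1 -> R) (v : T2 -> R) :
  bounded_measurable u -> bounded_measurable v ->
  \int[(m1 \x m2)%E]_p (u p.1 * v p.2) = (\int[m1]_x u x) * (\int[m2]_y v y).
Proof.
move=> bu bv.
have buv := bounded_measurable_tensor bu bv.
have iuv := @bounded_measurable_integrable _ _ _
  ((m1 \x m2)%E : probability _ _) _ buv.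
rewrite /Rintegral -(integral12_prod_meas1 iuv) /fubini_F/=.
have iu := bounded_measurable_integrable m1 bu.
have iv := bounded_measurable_integrable m2 bv.
rewrite (_ : (fun x => _) = fun x => ((\int[m2]_y v y) * u x)%:E); last first.
  apply/funext => x; rewrite EFinM /Rintegral fineK; last exact: integrable_fin_num.
  by rewrite muleC -integralZl//; apply: eq_integral => y _; rewrite EFinM.
rewrite -/(Rintegral m1 setT (fun x => (\int[m2]_y v y) * u x)) RintegralZl//.
by rewrite mulrC.
Qed.

Lemma torus_integralS d (f : torus R d.+1 -> R) : bounded_measurable f ->
  \int[torus_lebesgue R d.+1]_x f x =
  \int[(@circle_lebesgue R \x torus_lebesgue R d)%E]_p f (torus_cons p).
Proof.
move=> [mf [M fM]]; rewrite /Rintegral integral_distribution//.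
  exact/measurable_EFinP.
apply: bounded_measurable_integrable; split; last by exists M.
exact: (measurableT_comp mf (@measurable_torus_cons R d)).
Qed.

Lemma phase_torus_cons d (k : 'I_d.+1 -> int) (p : circle R * torus R d) :
  phase k (torus_cons p) =
  2 * pi * (k ord0)%:~R * cval p.1 + phase (fun i => k (lift ord0 i)) p.2.
Proof.
by rewrite /phase big_ord_recl tnth0; under eq_bigr do rewrite tnthS.
Qed.

Lemma bounded_measurable_circle_wave (k : int) :
  bounded_measurable (fun x : circle R => cos (2 * pi * k%:~R * cval x)) /\
  bounded_measurable (fun x : circle R => sin (2 * pi * k%:~R * cval x)).
Proof.
have mk : measurable_fun setT (fun x : circle R => 2 * pi * k%:~R * cval x).
  by apply: measurable_funM; [exact: measurable_cst|exact: measurable_cval].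
split; (split; [apply: measurableT_comp mk|exists 1 => x]).
- by apply: continuous_measurable_fun; exact: continuous_cos.
- exact: cos_max.
- by apply: continuous_measurable_fun; exact: continuous_sin.
- exact: sin_max.
Qed.

(** Induction on the dimension: the addition formulas split a wave into two products of a wave in
    the first coordinate and a wave in the others, to which Fubini applies. *)
Lemma torus_integral_wave d (k : 'I_d -> int) : (exists i, k i != 0) ->
  \int[torus_lebesgue R d]_x cos (phase k x) = 0 /\
  \int[torus_lebesgue R d]_x sin (phase k x) = 0.
Proof.
elim: d k => [k [[]]//|d ih k [i ki]].
set k' : 'I_d -> int := fun i => k (lift ord0 i).
have [b0c b0s] := bounded_measurable_circle_wave (k ord0).
have bc := @bounded_measurable_cos_phase R d k'.
have bs := @bounded_measurable_sin_phase R d k'.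
rewrite !torus_integralS//; last 2 first.
- exact: bounded_measurable_sin_phase.
- exact: bounded_measurable_cos_phase.
have prodE := product_Rintegral (@circle_lebesgue R) (torus_lebesgue R d).
(* A nonzero frequency sits in the first coordinate or in the remaining ones; either way every
   product has a vanishing factor. *)
have zero : (\int[@circle_lebesgue R]_x cos (2 * pi * (k ord0)%:~R * cval x) = 0 /\
    \int[@circle_lebesgue R]_x sin (2 * pi * (k ord0)%:~R * cval x) = 0) \/
    (\int[torus_lebesgue R d]_x cos (phase k' x) = 0 /\
     \int[torus_lebesgue R d]_x sin (phase k' x) = 0).
  have [k00|k00] := eqVneq (k ord0) 0; last by left; exact: circle_integral_wave.
  right; apply: ih; case: (unliftP ord0 i) => [j|] ij; last by rewrite ij k00 eqxx in ki.
  by exists j; rewrite /k' -ij.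
have int_ u v (bu : bounded_measurable u) (bv : bounded_measurable v) :=
  @bounded_measurable_integrable _ _ _
    ((@circle_lebesgue R \x torus_lebesgue R d)%E : probability _ _) _
    (bounded_measurable_tensor bu bv).
split.
- under eq_Rintegral do rewrite phase_torus_cons cosD.
  rewrite RintegralB//; [|exact: int_ b0c bc|exact: int_ b0s bs].
  rewrite (prodE _ _ b0c bc) (prodE _ _ b0s bs).
  by case: zero => -[-> ->]; rewrite ?mulr0 ?mul0r subr0.
- under eq_Rintegral do rewrite phase_torus_cons sinD.
  rewrite RintegralD//; [|exact: int_ b0s bc|exact: int_ b0c bs].
  rewrite (prodE _ _ b0s bc) (prodE _ _ b0c bs).
  by case: zero => -[-> ->]; rewrite ?mulr0 ?mul0r addr0.
Qed.

End orthogonality.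

(** * Lipschitz waves and Fourier coefficients *)

Section lipschitz.
Context {R : realType}.

Lemma lipschitz1_derivative (f df : R -> R) : (forall x : R, is_derive x 1 f (df x)) ->
  (forall x, `|df x| <= 1) -> forall a b, `|f a - f b| <= `|a - b|.
Proof.
move=> fdf df1 a b; wlog ab : a b / a <= b => [h|].
  by have [/h//|/ltW/h] := leP a b; rewrite distrC [leRHS]distrC.
have cf : continuous f.
  by move=> x; apply/differentiable_continuous/derivable1_diffP; exact: ex_derive.
have [c _ fE] := MVT_segment ab (fun x _ => fdf x) (continuous_subspaceT cf).
by rewrite distrC fE [leRHS]distrC normrM ler_piMl.
Qed.

Lemma cos_lipschitz (a b : R) : `|cos a - cos b| <= `|a - b|.
Proof.
apply: (lipschitz1_derivative (df := fun x => - sin x)) => x.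
by rewrite normrN sin_max.
Qed.

Lemma sin_lipschitz (a b : R) : `|sin a - sin b| <= `|a - b|.
Proof. by apply: (lipschitz1_derivative (df := cos)) => x; exact: cos_max. Qed.

Context {d : nat}.
Implicit Types (k : 'I_d -> int).

(** An upper bound for the Lipschitz constant of a wave; the added 1 keeps it positive at frequency
    0. *)
Definition wave_lipschitz k : R := 2 * pi * (1 + \sum_(i < d) `|(k i)%:~R|).

Lemma wave_lipschitz_gt0 k : 0 < wave_lipschitz k.
Proof. by rewrite !mulr_gt0 ?pi_gt0// ltr_pwDl// sumr_ge0. Qed.

Lemma torus_lip1_wave (g : R -> R) k :
  (forall a b, `|g a - g b| <= `|a - b|) ->
  (forall t (m : int), g (t + 2 * pi * m%:~R) = g t) ->
  torus_lip1 (fun x : torus R d => (wave_lipschitz k)^-1 * g (phase k x)).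
Proof.
move=> lip per x y; rewrite -mulrBr normrM gtr0_norm ?invr_gt0 ?wave_lipschitz_gt0//.
apply: lb_le_inf => [|_ [m _ <-]].
  by exists (\sum_(i < d) `|torus_diff x y i + 0%:~R|); exists (fun=> 0).
rewrite mulrC ler_pdivrMr ?wave_lipschitz_gt0//.
(* Translating [y] by the integer vector -m changes its phase by an integer multiple of 2 pi, so the
   value of [g] is unchanged; this handles each competitor in the wrap-around distance. *)
rewrite -(per (phase k y) (- \sum_(i < d) k i * m i)).
apply: le_trans (lip _ _) _.
have -> : phase k x - (phase k y + 2 * pi * (- \sum_(i < d) k i * m i)%:~R) =
    \sum_(i < d) 2 * pi * (k i)%:~R * (torus_diff x y i + (m i)%:~R).
  rewrite rmorphN rmorph_sum/= /phase opprD addrA -sumrB mulrN opprK mulr_sumr.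
  rewrite -big_split/=.
  by apply: eq_bigr => i _; rewrite /torus_diff intrM; ring.
apply: le_trans (ler_norm_sum _ _ _) _; rewrite mulr_suml; apply: ler_sum => i _.
rewrite normrM mulrC ler_wpM2l// normrM gtr0_norm ?mulr_gt0 ?pi_gt0//.
rewrite /wave_lipschitz ler_wpM2l ?mulr_ge0 ?pi_ge0//.
by rewrite (bigD1 i)//= addrCA lerDl addr_ge0// sumr_ge0.
Qed.

End lipschitz.

(** * Fourier coefficients, their uniqueness and their control by [W1] *)

Section fourier.
Local Open Scope complex_scope.
Context {R : realType} {d : nat}.
Implicit Types (k l : 'I_d -> int) (mu nu : complex_measure (torus R d) R).

Definition character k (x : torus R d) : R[i] := expi (phase k x).

(** The exponent carries a plus sign, opposite to the usual convention; this is the source of the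
    negated frequencies in the Fejér formulas. *)
Definition fourier mu k : R[i] := cm_integral mu (character k).

Lemma expiD (a b : R) : expi (a + b) = expi a * expi b.
Proof. by rewrite /expi cosD sinD; simpc; congr (_ +i* _); ring. Qed.

Lemma characterD k l x : character (fun i => k i + l i) x = character k x * character l x.
Proof. by rewrite /character phaseD expiD. Qed.

Lemma cbounded_measurable_character k : cbounded_measurable (character k).
Proof.
split; first exact: bounded_measurable_cos_phase.
exact: bounded_measurable_sin_phase.
Qed.

(** Test functions are real, so the cosine and the sine are tested separately after division by the
    Lipschitz bound; the triangle inequality accounts for the factor 2. *)
Lemma W1_fourier nu mu k :
  ((Normc.normc (fourier nu k - fourier mu k) / (2 * wave_lipschitz k : R))%:E
    <= W1 nu mu)%E.
Proof.
set L := wave_lipschitz k; have L0 : 0 < L := wave_lipschitz_gt0 k.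
set D := cm_sub nu mu.
have W (g : R -> R) : (forall a b, `|g a - g b| <= `|a - b|) ->
    (forall t (m : int), g (t + 2 * pi * m%:~R) = g t) ->
    bounded_measurable (fun x => g (phase k x)) ->
    ((Normc.normc (cm_integral D (fun x => (g (phase k x))%:C)) / L)%:E <= W1 nu mu)%E.
  move=> lip per bg; apply: ereal_sup_ubound.
  exists (fun x => L^-1 * g (phase k x)); first exact: torus_lip1_wave.
  congr (_%:E).
  rewrite (_ : (fun x => _) = (fun x => L^-1%:C * (g (phase k x))%:C)); last first.
    by apply/funext => x; rewrite rmorphM.
  rewrite cm_integralZ; last by split=> //; exact: bounded_measurable_cst.
  rewrite Normc.normcM mulrC; congr (_ * _).
  by rewrite /= expr0n addr0 sqrtr_sqr gtr0_norm// invr_gt0.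
have bc := @bounded_measurable_cos_phase R d k.
have bs := @bounded_measurable_sin_phase R d k.
have cC : cbounded_measurable (fun x : torus R d => (cos (phase k x))%:C).
  by split => //; exact: bounded_measurable_cst.
have cS : cbounded_measurable (fun x : torus R d => (sin (phase k x))%:C).
  by split => //; exact: bounded_measurable_cst.
have := W _ cos_lipschitz cosD2piz bc.
have := W _ sin_lipschitz sinD2piz bs.
rewrite /fourier -cm_integral_sub -/D; last exact: cbounded_measurable_character.
have -> : cm_integral D (character k) = cm_integral D (fun x => (cos (phase k x))%:C) +
    'i * cm_integral D (fun x => (sin (phase k x))%:C).
  rewrite -cm_integralZ// -cm_integralD//; last first.
    by apply: cbounded_measurableM => //; exact: cbounded_measurable_cst.
  by congr cm_integral; apply/funext => x; rewrite /character /expi; simpc.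
set S := cm_integral D _; set C := cm_integral D _.
have nCS : Normc.normc (C + 'i * S) <= Normc.normc C + Normc.normc S.
  apply: le_trans (le_normcD _ _) _.
  by rewrite Normc.normcM/= expr0n expr1n add0r sqrtr1 mul1r.
(* The value +oo makes the claim trivial, and -oo contradicts the bounds just obtained. *)
case: (W1 nu mu) => [w| |]; [|by move=> _ _; rewrite leey|by rewrite leeNy_eq].
rewrite !lee_fin => hS hC.
have L20 : 0 < 2 * L by exact: mulr_gt0.
rewrite ler_pdivrMr//; move: hS hC; rewrite !ler_pdivrMr// => hS hC.
by apply: (le_trans nCS); lra.
Qed.

Lemma fourier_lebesgue k :
  fourier (cm_of_measure (torus_lebesgue R d)) k = ([forall i, k i == 0])%:R.
Proof.
rewrite /fourier cm_integral_measure; last exact: cbounded_measurable_character.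
have [/forallP k0|] := boolP [forall i, k i == 0].
  have kE : k = (fun=> 0) by apply/funext => i; apply/eqP.
  have -> : character k = (fun=> 1) :> (torus R d -> R[i]).
    by apply/funext => x; rewrite /character kE phase0 /expi cos0 sin0.
  have one (r : R) : \int[torus_lebesgue R d]_x r = r.
    rewrite Rintegral_cst// -[RHS]mulr1; congr (_ * _).
    transitivity (fine (1%E : \bar R)) => //; congr fine.
    exact: (@probability_setT _ _ _ (torus_lebesgue R d)).
  by rewrite !one.
rewrite negb_forall => /existsP ki.
by have [-> ->] 
  := @torus_integral_wave R d k ki.
Qed.

Lemma fourier_unique mu nu : (forall k, fourier mu k = fourier nu k) -> cm_eq mu nu.
Proof.
move=> munu.
have bc := @bounded_measurable_cos_phase R d.
have bs := @bounded_measurable_sin_phase R d.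
have coef k : [/\ charge_integral (cm_Re mu) (fun x => cos (phase k x)) =
      charge_integral (cm_Re nu) (fun x => cos (phase k x)),
    charge_integral (cm_Re mu) (fun x => sin (phase k x)) =
      charge_integral (cm_Re nu) (fun x => sin (phase k x)),
    charge_integral (cm_Im mu) (fun x => cos (phase k x)) =
      charge_integral (cm_Im nu) (fun x => cos (phase k x)) &
    charge_integral (cm_Im mu) (fun x => sin (phase k x)) =
      charge_integral (cm_Im nu) (fun x => sin (phase k x))].
  (* A complex coefficient mixes the two parts of the measure. Passing to -k flips only the sine, so
     the coefficients at k and -k together determine all four real integrals. *)
  have cN (rho : {charge set (torus R d) -> \bar R}) :
      charge_integral rho (fun x => cos (phase (fun i => - k i) x)) =
      charge_integral rho (fun x => cos (phase k x)).
    by congr charge_integral; apply/funext => x; rewrite phaseN cosN.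
  have sN (rho : {charge set (torus R d) -> \bar R}) :
      charge_integral rho (fun x => sin (phase (fun i => - k i) x)) =
      - charge_integral rho (fun x => sin (phase k x)).
    rewrite -(ilN (integral_like_charge rho))//.
    by congr charge_integral; apply/funext => x; rewrite phaseN sinN.
  have := munu (fun i => - k i); have := munu k.
  rewrite /fourier /cm_integral /character /= !cN !sN => -[e1 e2] [e3 e4].
  by split; lra.
have part (rho1 rho2 : {charge set (torus R d) -> \bar R}) :=
  @charge_fourier_unique R d rho1 rho2.
move=> A mA; apply: eq_ReIm.
- apply: EFin_inj; apply: (part (cm_Re mu) (cm_Re nu)) => // k.
  by have [] := coef k.
- apply: EFin_inj; apply: (part (cm_Im mu) (cm_Im nu)) => // k.
  by have [] := coef k.
Qed.

Lemma fourier0 mu : fourier mu (fun=> 0) = mu setT.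
Proof.
have -> : mu setT = complex.Re (mu setT) +i* complex.Im (mu setT) by case: (mu setT).
have c1 : character (fun=> 0) = (fun=> 1) :> (torus R d -> R[i]).
  by apply/funext => x; rewrite /character phase0 /expi cos0 sin0.
have one (rho : {charge set (torus R d) -> \bar R}) :
    charge_integral rho (fun=> 1) = fine (rho setT).
  by rewrite -charge_integral_indic// indicT.
rewrite /fourier c1 /cm_integral /= !one.
by rewrite !(il0 (integral_like_charge _)) subr0 addr0.
Qed.

End fourier.

(** * The Fejér multiplier *)

Section fejer.
Local Open Scope complex_scope.
Context {R : realType} {d : nat}.
Implicit Types (k : 'I_d -> int) (mu : complex_measure (torus R d) R).

Definition fejer_weight n (m : int) : R := 1 - `|m|%N%:R / n.+1%:R.

Definition fejer_freq n (j : {ffun 'I_d -> 'I_n.*2.+1}) (i : 'I_d) : int :=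
  (j i)%:Z - n%:Z.

Lemma expi_sum (a : 'I_d -> R) : expi (\sum_(i < d) a i) = \prod_(i < d) expi (a i).
Proof.
apply: (big_morph (@expi R)); first exact: expiD.
by rewrite /expi cos0 sin0.
Qed.

(** Distributing the product over the sums turns the kernel into a trigonometric polynomial that
    separates [x] from [y]. *)
Lemma fejerE n (x y : torus R d) : fejer n (torus_diff x y) =
  \sum_(j : {ffun 'I_d -> 'I_n.*2.+1})
    (\prod_(i < d) fejer_weight n (fejer_freq j i))%:C *
    character (fejer_freq j) x * character (fun i => - fejer_freq j i) y.
Proof.
rewrite /fejer /fejer1 bigA_distr_bigA; apply: eq_bigr => j _.
rewrite big_split/= rmorph_prod -mulrA; congr (_ * _).
rewrite -expi_sum /character -expiD phaseN; congr expi.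
by rewrite /phase -sumrB; apply: eq_bigr => i _; rewrite /fejer_freq /torus_diff; ring.
Qed.

Lemma fejer_convE n mu x : fejer_conv n mu x =
  \sum_(j : {ffun 'I_d -> 'I_n.*2.+1})
    (\prod_(i < d) fejer_weight n (fejer_freq j i))%:C *
    fourier mu (fun i => - fejer_freq j i) * character (fejer_freq j) x.
Proof.
rewrite /fejer_conv; under eq_fun do rewrite fejerE.
have bc k := @cbounded_measurable_character R d k.
rewrite cm_integral_sum => [|j]; last first.
  by apply: cbounded_measurableM => //; exact: cbounded_measurable_cst.
by apply: eq_bigr => j _; rewrite cm_integralZ// mulrAC.
Qed.

(** Each inner sum has at most one term, so this is the product of max(0, 1 - |k_i| / (n + 1)). The
    form with sums lets it expand over the same indices as the kernel. *)
Definition fejer_multiplier n k : R :=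
  \prod_(i < d) \sum_(j < n.*2.+1 | j%:Z - n%:Z == - k i) fejer_weight n (j%:Z - n%:Z).

(** By orthogonality, only the term of the trigonometric polynomial with frequency -k survives. *)
Lemma fourier_fejer_conv n mu k :
  fourier (cm_density (torus_lebesgue R d) (fejer_conv n mu)) k =
  (fejer_multiplier n k)%:C * fourier mu k.
Proof.
have bc l := @cbounded_measurable_character R d l.
have bcst (a : R[i]) := @cbounded_measurable_cst _ (torus R d) R a.
have bp : cbounded_measurable (fejer_conv n mu).
  rewrite (_ : fejer_conv n mu = fun x => \sum_(j : {ffun 'I_d -> 'I_n.*2.+1})
    (\prod_(i < d) fejer_weight n (fejer_freq j i))%:C *
    fourier mu (fun i => - fejer_freq j i) * character (fejer_freq j) x).
    by apply: cbounded_measurable_sum => j; exact: cbounded_measurableM.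
  by apply/funext => x; rewrite fejer_convE.
rewrite {1}/fourier cm_integral_density//.
rewrite (_ : (fun x => _) = fun x => \sum_(j : {ffun 'I_d -> 'I_n.*2.+1})
    (\prod_(i < d) fejer_weight n (fejer_freq j i))%:C *
    fourier mu (fun i => - fejer_freq j i) *
    character (fun i => k i + fejer_freq j i) x); last first.
  apply/funext => x; rewrite fejer_convE mulr_sumr; apply: eq_bigr => j _.
  by rewrite characterD mulrCA.
rewrite cm_integral_sum => [|j]; last exact: cbounded_measurableM.
under eq_bigr => j _.
  rewrite cm_integralZ// -/(fourier _ _) fourier_lebesgue; over.
rewrite /fejer_multiplier.
(* The side conditions become zero terms, so that the product of sums expands over all [j] and can
   be compared term by term. *)
under [in RHS]eq_bigr do rewrite big_mkcond.
rewrite bigA_distr_bigA/= rmorph_sum/= mulr_suml; apply: eq_bigr => j _.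
have [/forallP kj|] := boolP [forall i, k i + fejer_freq j i == 0].
  have jk i : fejer_freq j i = - k i.
    by apply/eqP; rewrite -addr_eq0 addrC kj.
  rewrite mulr1; congr (_%:C * fourier mu _).
    by apply: eq_bigr => i _; rewrite -/(fejer_freq j i) jk eqxx.
  by apply/funext => i; rewrite jk opprK.
rewrite negb_forall => /existsP[i kji].
rewrite mulr0 (bigD1 i)//= -/(fejer_freq j i) ifN ?mul0r//.
by apply: contra kji => /eqP ->; rewrite subrr.
Qed.

Lemma fejer_multiplier_bounds n k : (exists i, k i != 0) ->
  0 <= fejer_multiplier n k <= 1 - n.+1%:R^-1.
Proof.
have inv1 : n.+1%:R^-1 <= 1 :> R by rewrite invf_le1// ler1n.
(* Every coordinate contributes a factor in [0, 1], and a nonzero integer has absolute value at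
   least 1, which yields the gap. The sum is empty when |m| > n. *)
have factor (m : int) : 0 <= \sum_(j < n.*2.+1 | j%:Z - n%:Z == m)
    fejer_weight n (j%:Z - n%:Z) <= (if m == 0 then 1 else 1 - n.+1%:R^-1).
  case: (pickP (fun j : 'I_n.*2.+1 => j%:Z - n%:Z == m)) => [j jm|none]; last first.
    by rewrite big_pred0//= lexx/=; case: ifP => _; rewrite ?ler01 ?subr_ge0.
  rewrite (bigD1 j)//= big1 => [|i /andP[/eqP im ij]]; last first.
    have /addIr[] := etrans im (esym (eqP jm)).
    by move=> /val_inj e; rewrite e eqxx in ij.
  rewrite addr0 (eqP jm) /fejer_weight.
  have mn : (`|m| <= n)%N.
    by rewrite -(eqP jm); have := ltn_ord j; lia.
  rewrite subr_ge0 ler_pdivrMr// mul1r ler_nat (leq_trans mn)//=.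
  case: ifPn => [_|m0]; first by rewrite gerBl divr_ge0.
  by rewrite lerD2l lerN2 ler_peMl ?invr_ge0// ler1n absz_gt0.
move=> [i ki]; apply/andP; split.
  by apply: prodr_ge0 => l _; have /andP[] := factor (- k l).
rewrite /fejer_multiplier (bigD1 i)//=; have /andP[f0 f1] := factor (- k i).
rewrite oppr_eq0 (negbTE ki) in f1.
apply: le_trans f1; apply: ler_piMr => //.
apply: (le_trans (y := \prod_(l < d | l != i) 1)); last by rewrite big1.
apply: ler_prod => l _; have /andP[g0 g1] := factor (- k l).
rewrite g0 (le_trans g1)//; case: ifP => // _.
Qed.

End fejer.

(** * The lower bound for Fejér convolutions *)

Theorem theorem2p7 (R : realType) (d : nat) (d_gt0 : (0 < d)%N)
    (mu : complex_measure (torus R d) R) (mu_M : in_M mu)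
    (mu_neq : ~ cm_eq mu (cm_of_measure (torus_lebesgue R d))) :
  exists c : R, 0 < c /\
    forall n : nat, (0 < n)%N ->
      ((c / n.+1%:R)%:E
         <= W1 (cm_density (torus_lebesgue R d) (fejer_conv n mu)) mu)%E.
Proof.
have [_ muT] := mu_M.
(* Otherwise [mu] would have the coefficients of Lebesgue measure: total mass 1 fixes the one at
   frequency 0. *)
have [k [k0 fk]] : exists k : 'I_d -> int, (exists i, k i != 0) /\ fourier mu k != 0.
  apply: contrapT => nk; apply: mu_neq; apply: fourier_unique => k.
  rewrite fourier_lebesgue; have [/forallP k0|] := boolP [forall i, k i == 0].
    have kE : k = (fun=> 0) by apply/funext => i; apply/eqP.
    by rewrite kE fourier0 muT.
  rewrite negb_forall => /existsP ki; apply/eqP.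
  by apply: contrapT => /negP fk; apply: nk; exists k.
(* The constant of [W1_fourier] at the chosen frequency, which does not depend on [n]. *)
exists (Normc.normc (fourier mu k) / (2 * wave_lipschitz k)).
have L0 : 0 < 2 * wave_lipschitz k :> R by rewrite mulr_gt0// wave_lipschitz_gt0.
have nfk : 0 < Normc.normc (fourier mu k).
  rewrite lt_neqAle eq_sym; apply/andP; split.
    by apply: contra fk => /eqP/Normc.eq0_normc ->.
  by case: (fourier mu k) => a b /=; exact: sqrtr_ge0.
split; first exact: divr_gt0.
move=> n _; apply: le_trans (W1_fourier _ mu k).
rewrite lee_fin fourier_fejer_conv mulrAC ler_pM2r ?invr_gt0//.
have /andP[m0 m1] := @fejer_multiplier_bounds R d n k k0.
(* The difference of the coefficients is [fourier mu k] times the multiplier minus 1, a number of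
   modulus at least 1 / (n + 1). *)
rewrite -[X in _ - X]mul1r -mulrBl Normc.normcM mulrC ler_wpM2r ?(ltW nfk)//.
rewrite -(rmorph1 (real_complex R)) -rmorphB /= expr0n addr0 sqrtr_sqr distrC.
have m_le1 : fejer_multiplier n k <= 1 :> R by rewrite (le_trans m1)// gerBl.
rewrite ger0_norm ?subr_ge0//. by rewrite lerBrDl -lerBrDr.
Qed.
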